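(* Let $\mu_1>0$, $\mu_2=0$ and suppose $b_1=b_2=\varepsilon_0=1$. Then the first return map $\mathcal F_{(\mu_1,0)}=Loc_1\circ\Psi_{2\to1}\circ Loc_2\circ\Psi_{1\to2}$ to $\mathrm{Out}(\mathbf C_1)$ may be written as $\mathcal F_{(\mu_1,0)}(\overline y,\overline\theta)=(\mathcal F_1,\mathcal F_2)$, where $$\mathcal F_1=\mu_1^{\delta-1}\big[\overline y+\phi_1(\overline y,\overline\theta)\big]^{\delta},$$ $$\mathcal F_2=\overline\theta+\xi+\mu_1\psi_1(\overline y,\overline\theta)-\omega K_F\ln(\mu_1)-\omega K_F\ln\big[\overline y+\phi_1(\overline y,\overline\theta)\big],$$ with $\delta=\delta_1\delta_2$, $\xi=\xi_1+\xi_2$ and $K_F=\dfrac1{e_2+w_2^{(2)}}+\dfrac{\delta_2}{e_1+w_2^{(1)}}$.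
   Context: Setting: a flow with two hyperbolic periodic solutions $\mathbf C_1,\mathbf C_2$, depending on $\mu=(\mu_1,\mu_2)$, frequency $\omega>0$, saddle exponents $-c_i<0<e_i$ with $c_i>e_i$. Near $\mathbf C_i$, in rescaled coordinates $(y_1^{(i)},y_2^{(i)},\theta^{(i)})$, $\theta^{(i)}\in\mathbb S^1$, the flow is $$\dot y_1^{(i)}=(-c_i+\|\mu\|g_1^{(i)})y_1^{(i)},\quad \dot y_2^{(i)}=(e_i+\|\mu\|g_2^{(i)})y_2^{(i)},\quad\dot\theta^{(i)}=\omega,$$ with $g_j^{(i)}$ functions of $(y_1^{(i)},y_2^{(i)},\theta^{(i)};\mu)$. Cross sections: $\mathrm{In}(\mathbf C_i)\subset\{y_1^{(i)}=\varepsilon_0/\|\mu\|\}$ with coordinates $(y_2^{(i)},\theta^{(i)})$; $\mathrm{In}^+(\mathbf C_i)$ is its part with $y_2^{(i)}>0$; $\mathrm{Out}(\mathbf C_i)\subset\{y_2^{(i)}=\varepsilon_0/\|\mu\|\}$ with coordinates $(\overline y_1^{(i)},\overline\theta^{(i)})$. For the orbit starting at $q_0\in\mathrm{In}^+(\mathbf C_i)$ put $w_j^{(i)}=\frac1t\int_0^t\|\mu\|g_j^{(i)}\,ds$ (integral along the orbit), evaluated at $t=$ the time of flight to $\mathrm{Out}(\mathbf C_i)$, and $\delta_i=\dfrac{c_i-w_1^{(i)}}{e_i+w_2^{(i)}}$ (functions of $q_0$ and $\mu$). The local maps $Loc_i:\mathrm{In}^+(\mathbf C_i)\to\mathrm{Out}(\mathbf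 C_i)$ are $$\overline y_1^{(i)}=\frac{\varepsilon_0}{\|\mu\|}\Big[\frac{\varepsilon_0}{\|\mu\|y_2^{(i)}}\Big]^{-\delta_i},\qquad\overline\theta^{(i)}=\theta^{(i)}+\frac{\omega}{e_i+w_2^{(i)}}\ln\Big(\frac{\varepsilon_0}{\|\mu\|y_2^{(i)}}\Big).$$ The global maps are $\Psi_{1\to2}:\mathrm{Out}(\mathbf C_1)\to\mathrm{In}(\mathbf C_2)$, $y_2^{(2)}=b_1\overline y_1^{(1)}+\frac{\mu_1}{\|\mu\|}\phi_1(\overline y_1^{(1)},\overline\theta^{(1)})$, $\theta^{(2)}=\overline\theta^{(1)}+\xi_1+\mu_1\psi_1(\overline y_1^{(1)},\overline\theta^{(1)})$; $\Psi_{2\to1}:\mathrm{Out}(\mathbf C_2)\to\mathrm{In}(\mathbf C_1)$, $y_2^{(1)}=b_2\overline y_1^{(2)}+\frac{\mu_2}{\|\mu\|}\phi_2(\overline y_1^{(2)},\overline\theta^{(2)})$, $\theta^{(1)}=\overline\theta^{(2)}+\xi_2+\mu_2\psi_2(\overline y_1^{(2)},\overline\theta^{(2)})$, with $b_i\neq0$, $\xi_i\in\mathbb R$, $\phi_1>0$ and $\phi_i,\psi_i$ real functions. In the claim $(\overline y,\overline\theta)=(\overline y_1^{(1)},\overline\theta^{(1)})\in\mathrm{Out}(\mathbf C_1)$, where $\overline y_1^{(1)}\ge 0$, and $\delta_i,w_2^{(i)}$ are evaluated at the successive points of the orbit on $\mathrm{In}^+(\mathbf C_2)$, $\mathrm{In}^+(\mathbf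 C_1)$. *)

(* Defs.v *)
From HB Require Import structures.
From mathcomp Require Import all_boot all_order all_algebra.
From mathcomp Require Import generic_quotient ring_quotient.
From mathcomp Require Import all_classical all_reals all_analysis.

Set Implicit Arguments.
Unset Strict Implicit.
Unset Printing Implicit Defensive.

Import Order.TTheory GRing.Theory Num.Theory.
Import numFieldNormedType.Exports.

Local Open Scope classical_set_scope.
Local Open Scope ring_scope.

(* The circle S^1 is the quotient group R / 2 pi Z; functions of an angle are
   functions on this quotient, i.e. 2 pi-periodic functions. *)
Definition full_turns (R : realType) : {pred R} :=
  fun x => `[< exists k : int, x = (pi *+ 2) *~ k >].

Lemma full_turns_zmod_closed (R : realType) : zmod_closed (@full_turns R).
Proof.
split; first by apply/asboolP; exists 0; rewrite mulr0z.
move=> _ _ /asboolP[k ->] /asboolP[l ->].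
by apply/asboolP; exists (k - l); rewrite mulrzBr.
Qed.

HB.instance Definition _ (R : realType) :=
  GRing.isZmodClosed.Build R (@full_turns R) (@full_turns_zmod_closed R).

Definition circle (R : realType) := {ideal_quot (@full_turns R)}.

Definition angle (R : realType) (x : R) : circle R := (\pi x)%qT.

Definition norm2 (R : realType) (v : R * R) : R :=
  Num.sqrt (v.1 ^+ 2 + v.2 ^+ 2).

(* A hyperbolic periodic solution C together with the flow near it.
   - cycle_c, cycle_e: C has saddle exponents - c < 0 < e.
   - cycle_g1, cycle_g2: the functions g_j (y1, y2, theta; mu).
   - In, Out: the cross sections, depending on mu, in the coordinates
     (y2, theta) and (y1, theta) respectively.
   - orbit_y1 mu q, orbit_y2 mu q, orbit_theta mu q: the coordinates, as
     functions of time, of the orbit starting at the point of In with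
     coordinates q; orbit_theta is a real lift of the angle.
   That the orbits solve the equations of motion is [local_flow] below. *)
Record hyp_cycle (R : realType) := HypCycle {
  cycle_c : R;
  cycle_e : R;
  cycle_e_gt0 : 0 < cycle_e;
  cycle_ltec : cycle_e < cycle_c;
  cycle_g1 : R -> R -> circle R -> R * R -> R;
  cycle_g2 : R -> R -> circle R -> R * R -> R;
  In : R * R -> set (R * circle R);
  Out : R * R -> set (R * circle R);
  orbit_y1 : R * R -> R * circle R -> R -> R;
  orbit_y2 : R * R -> R * circle R -> R -> R;
  orbit_theta : R * R -> R * circle R -> R -> R
}.

Definition In_plus (R : realType) (C : hyp_cycle R) (mu : R * R) :
    set (R * circle R) :=
  [set q | In C mu q /\ 0 < q.1].

(* ||mu|| g_j at time s along the orbit of q *)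
Definition rate1 (R : realType) (C : hyp_cycle R) (mu : R * R)
    (q : R * circle R) (s : R) : R :=
  norm2 mu * cycle_g1 C (orbit_y1 C mu q s) (orbit_y2 C mu q s)
                        (angle (orbit_theta C mu q s)) mu.

Definition rate2 (R : realType) (C : hyp_cycle R) (mu : R * R)
    (q : R * circle R) (s : R) : R :=
  norm2 mu * cycle_g2 C (orbit_y1 C mu q s) (orbit_y2 C mu q s)
                        (angle (orbit_theta C mu q s)) mu.

(* First hitting time of {y2 = eps0 / ||mu||}. *)
Definition flight_time (R : realType) (eps0 : R) (C : hyp_cycle R) (mu : R * R)
    (q : R * circle R) : R :=
  inf [set t | 0 <= t /\ orbit_y2 C mu q t = eps0 / norm2 mu].

(* The orbit of every q in In^+ starts at q, solves the equations of motion
   up to the time of flight, and then reaches Out.  The equations are required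
   on the open time interval, with continuity up to its end points. *)
Definition local_flow (R : realType) (omega eps0 : R) (C : hyp_cycle R)
    (mu : R * R) : Prop :=
  forall q : R * circle R, In_plus C mu q ->
  let y1 := orbit_y1 C mu q in
  let y2 := orbit_y2 C mu q in
  let theta := orbit_theta C mu q in
  let T := flight_time eps0 C mu q in
  [/\ [/\ y1 0 = eps0 / norm2 mu, y2 0 = q.1 & angle (theta 0) = q.2],
      [/\ {within `[0, T], continuous y1},
          {within `[0, T], continuous y2} &
          {within `[0, T], continuous theta}],
      {within `[0, T], continuous (rate1 C mu q)} /\
      {within `[0, T], continuous (rate2 C mu q)},
      (forall t : R, 0 < t < T ->
         [/\ is_derive t 1 y1 ((- cycle_c C + rate1 C mu q t) * y1 t),
             is_derive t 1 y2 ((cycle_e C + rate2 C mu q t) * y2 t) &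
             is_derive t 1 theta omega]) &
      y2 T = eps0 / norm2 mu /\ Out C mu (y1 T, angle (theta T))].

(* w_1 and w_2: the means of ||mu|| g_j along the orbit of q up to its time of
   flight T (with value 0 in the degenerate case T = 0). *)
Definition w1 (R : realType) (eps0 : R) (C : hyp_cycle R) (mu : R * R)
    (q : R * circle R) : R :=
  let T := flight_time eps0 C mu q in
  T^-1 * (\int[lebesgue_measure]_(s in `[0, T]) rate1 C mu q s).

Definition w2 (R : realType) (eps0 : R) (C : hyp_cycle R) (mu : R * R)
    (q : R * circle R) : R :=
  let T := flight_time eps0 C mu q in
  T^-1 * (\int[lebesgue_measure]_(s in `[0, T]) rate2 C mu q s).

Definition delta (R : realType) (eps0 : R) (C : hyp_cycle R) (mu : R * R)
    (q : R * circle R) : R :=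
  (cycle_c C - w1 eps0 C mu q) / (cycle_e C + w2 eps0 C mu q).

(* The local map; only its values on In^+ are meaningful. *)
Definition Loc (R : realType) (omega eps0 : R) (C : hyp_cycle R) (mu : R * R)
    (q : R * circle R) : R * circle R :=
  let x := eps0 / (norm2 mu * q.1) in
  (eps0 / norm2 mu * x `^ (- delta eps0 C mu q),
   q.2 + angle (omega / (cycle_e C + w2 eps0 C mu q) * ln x)).

Record connection (R : realType) := Connection {
  conn_b : R;
  conn_b_neq0 : conn_b != 0;
  conn_xi : R;
  conn_phi : R -> circle R -> R;
  conn_psi : R -> circle R -> R
}.

(* The global map along a connection; the component of mu that governs it,
   mu_1 for 1 -> 2 and mu_2 for 2 -> 1, is passed as nu. *)
Definition Psi (R : realType) (K : connection R) (mu : R * R) (nu : R)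
    (p : R * circle R) : R * circle R :=
  (conn_b K * p.1 + nu / norm2 mu * conn_phi K p.1 p.2,
   p.2 + angle (conn_xi K + nu * conn_psi K p.1 p.2)).

Definition first_return (R : realType) (omega eps0 : R) (C1 C2 : hyp_cycle R)
    (K12 K21 : connection R) (mu : R * R) : R * circle R -> R * circle R :=
  Loc omega eps0 C1 mu \o Psi K21 mu mu.2 \o
  Loc omega eps0 C2 mu \o Psi K12 mu mu.1.

(* Main.v *)
(* With eps0 = 1 and x = ||mu|| y2, the local map is y2 |-> x^delta / ||mu||,
   with phase shift - omega / (e + w2) * ln x.  As mu = (mu.1, 0), the point on
   In(C2) has x = mu.1 (y + phi1), and Psi_{2->1} leaves the first coordinate
   unchanged, so the point on In(C1) has x = (mu.1 (y + phi1))^delta2. *)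

Require Import Defs.
From HB Require Import structures.
From mathcomp Require Import all_boot all_order all_algebra.
From mathcomp Require Import all_classical all_reals all_analysis.
From mathcomp Require Import generic_quotient ring.
Import Order.TTheory GRing.Theory Num.Theory.
Import numFieldNormedType.Exports.
Local Open Scope ring_scope.

(** The quotient map is additive; this collects phase shifts added on the circle into the angle of a
    single real number. *)
Lemma angleD (R : realType) (a b : R) : angle (a + b) = angle a + angle b.
Proof. exact: (raddfD (\pi_(circle R)%qT)). Qed.

Lemma norm2_first_axis (R : realType) (mu : R * R) :
  0 < mu.1 -> mu.2 = 0 -> norm2 mu = mu.1.
Proof.
by move=> mu1_gt0 mu2_eq0; rewrite /norm2 mu2_eq0 expr0n addr0 sqrtr_sqr gtr0_norm.
Qed.

Lemma Loc_powR (R : realType) (omega : R) (C : hyp_cycle R) (mu : R * R)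
    (q : R * circle R) :
  0 < norm2 mu -> 0 < q.1 ->
  Loc omega 1 C mu q =
  ((norm2 mu * q.1) `^ delta 1 C mu q / norm2 mu,
   q.2 + angle (- (omega / (cycle_e C + w2 1 C mu q) * ln (norm2 mu * q.1)))).
Proof.
move=> mu_gt0 q_gt0; have mq_gt0 : 0 < norm2 mu * q.1 by rewrite mulr_gt0.
rewrite /Loc !div1r lnV ?posrE// mulrN; congr (_, _).
(* The inverse is read as a power with exponent -1, so the exponents multiply: (-1)(-delta) =
   delta. *)
by rewrite -[(_ * q.1)^-1]powR_inv1 ?(ltW mq_gt0)// -powRrM mulrNN mul1r mulrC.
Qed.

Theorem lemma6p4 (R : realType) (omega eps0 : R) (mu : R * R)
    (C1 C2 : hyp_cycle R) (K12 K21 : connection R)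
    (omega_gt0 : 0 < omega)
    (flow1 : local_flow omega eps0 C1 mu)
    (flow2 : local_flow omega eps0 C2 mu)
    (phi1_gt0 : forall (y : R) (theta : circle R),
       Out C1 mu (y, theta) -> 0 < conn_phi K12 y theta)
    (mu1_gt0 : 0 < mu.1) (mu2_eq0 : mu.2 = 0)
    (b1_eq1 : conn_b K12 = 1) (b2_eq1 : conn_b K21 = 1)
    (eps0_eq1 : eps0 = 1)
    (y : R) (theta : circle R)
    (p_Out1 : Out C1 mu (y, theta)) (y_ge0 : 0 <= y) :
  (* the successive points of the orbit of (y, theta) on In(C2) and In(C1) *)
  let q2 := Psi K12 mu mu.1 (y, theta) in
  let q1 := Psi K21 mu mu.2 (Loc omega eps0 C2 mu q2) in
  In C2 mu q2 -> In C1 mu q1 ->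
  let delta1 := delta eps0 C1 mu q1 in
  let delta2 := delta eps0 C2 mu q2 in
  let d := delta1 * delta2 in
  let xi := conn_xi K12 + conn_xi K21 in
  let KF := 1 / (cycle_e C2 + w2 eps0 C2 mu q2)
            + delta2 / (cycle_e C1 + w2 eps0 C1 mu q1) in
  let phi1 := conn_phi K12 y theta in
  let psi1 := conn_psi K12 y theta in
  first_return omega eps0 C1 C2 K12 K21 mu (y, theta) =
  (mu.1 `^ (d - 1) * (y + phi1) `^ d,
   theta + angle (xi + mu.1 * psi1 - omega * KF * ln mu.1
                  - omega * KF * ln (y + phi1))).
Proof.
move=> q2 q1 _ _ delta1 delta2 d xi KF phi1 psi1; subst eps0.
have normE := norm2_first_axis R mu mu1_gt0 mu2_eq0.
have mu_neq0 : mu.1 != 0 by rewrite gt_eqF.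
(* This sum is the first coordinate of [q2]; its positivity allows [Loc_powR] at [q2] and the
   splitting of powers and logarithms below. *)
have s_gt0 : 0 < y + phi1 by rewrite ltr_wpDl// phi1_gt0.
have ms_gt0 : 0 < mu.1 * (y + phi1) by rewrite mulr_gt0.
have q21 : q2.1 = y + phi1 by rewrite /q2/= b1_eq1 normE divff// !mul1r.
have norm_gt0 : 0 < norm2 mu by rewrite normE.
have LocE : Loc omega 1 C2 mu q2 =
    ((mu.1 * (y + phi1)) `^ delta2 / mu.1,
     q2.2 + angle (- (omega / (cycle_e C2 + w2 1 C2 mu q2)
                      * ln (mu.1 * (y + phi1))))).
  by rewrite Loc_powR ?q21// normE.
have q11 : q1.1 = (mu.1 * (y + phi1)) `^ delta2 / mu.1.
  by rewrite /q1 LocE/= b2_eq1 mu2_eq0 !mul0r mul1r addr0.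
(* As [mu.2] = 0, the second connection adds only its constant phase [conn_xi K21]. *)
have q12 : q1.2 = theta + angle (conn_xi K12 + mu.1 * psi1)
    + angle (- (omega / (cycle_e C2 + w2 1 C2 mu q2)
                * ln (mu.1 * (y + phi1)))) + angle (conn_xi K21).
  by rewrite /q1 LocE/= mu2_eq0 mul0r addr0.
have -> : first_return omega 1 C1 C2 K12 K21 mu (y, theta) =
          Loc omega 1 C1 mu q1 by [].
rewrite Loc_powR ?q11 ?divr_gt0 ?powR_gt0// normE -/delta1.
have -> : mu.1 * ((mu.1 * (y + phi1)) `^ delta2 / mu.1)
          = (mu.1 * (y + phi1)) `^ delta2 by field.
congr (_, _).
- rewrite -powRrM mulrC (mulrC delta2) powRM ?ltW// mulrA; congr (_ * _).
  (* Dividing by [mu.1] lowers the exponent from d to d - 1; since d - 1 may vanish, [powRD] asks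
     for a nonzero base. *)
  by rewrite powRD ?mu_neq0 ?implybT// powR_inv1 ?ltW// mulrC.
(* The logarithm of the power brings down [delta2], which yields the second summand of [KF]; the
   first comes from the phase of [q1]. *)
- rewrite q12 ln_powR lnM ?posrE// -!addrA; congr (_ + _).
  by rewrite -!angleD; congr angle; rewrite /KF /xi; ring.
Qed.
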